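(* Let $f:\mathcal X\to\mathcal Y$ be a hypothesis in $\mathcal F$ and let $r_n$ be the probability ratio estimated from the obtained set of samples $S_n$. Suppose that the class of functions $\mathcal G$ of the maximum mean discrepancy contains the function $(v,y)\mapsto \partial\phi(r^*(v,y))/a$ for some constant $a>0$, where $\partial\phi$ denotes an element of the subdifferential of $\phi$, and suppose that $c_\ell\le r^*(V,f(X))\le c_u$ almost surely, where $c_\ell\in(0,1]$ and $c_u\in[1,\infty)$. Then, with probability at least $1-e^{-t}$, $$D_\phi(f)\le D_{\phi,n}(f)+a\,D_{\mathrm{MMD},f,n}(r_n)+c\sqrt{\frac{2t}{n}},$$ where $c=2\max\{\phi(c_\ell),\phi(c_u)\}+\partial\phi(c_u)c_u+\partial\phi(c_u)-2\partial\phi(c_\ell)$.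
   Context: Setting: $\mathcal X=\mathcal V\times\mathcal W$ is the input domain, where $v\in\mathcal V$ is the ''viewpoint'' component of the input $x=(v,w)$; $\mathcal Y=\{1,\dots,c_0\}$ is a finite set of labels. $\mathcal F$ is a class of measurable functions $f:\mathcal X\to\mathcal Y$. $(X_1,Y_1),\dots,(X_n,Y_n)$ ($n\ge2$) are i.i.d. samples from an unknown probability measure $\mu$ on $\mathcal X\times\mathcal Y$, forming $S_n$; $(X,Y)$ is a generic pair with the same law; $V_i$ (resp. $V$) is the viewpoint of $X_i$ (resp. $X$). $t>0$. $\phi:\mathbb R^+\to\mathbb R$ is convex and lower semicontinuous with $\phi(1)=0$; it is differentiable on $\mathbb R^+$ except possibly at $1$, and its subdifferential at $1$ contains $0$. $\partial\phi(u)$ denotes a fixed choice of an element of the subdifferential of $\phi$ at $u$. Let $P_V\otimes P_{f(X)}$ be the product of the marginal laws of $V$ and $f(X)$ and let $P_{V,f(X)}$ be their joint law on $\mathcal V\times\mathcal Y$ (compact domain); $P_V\otimes P_{f(X)}$ is assumed absolutely continuous with respect to $P_{V,f(X)}$, and $r^*=d(P_V\otimes P_{f(X)})/dP_{V,f(X)}$. The dependency measure is $$D_\phi(f)=\int\phi(r^* )\,dP_{V,f(X)}=\mathbb E[\phi(r^*(V,f(X)))].$$ $\mathcal G$ is a set of functions $g:\mathcal V\times\mathcal Y\to\mathbb R$. For $r:\mathcal V\times\mathcal Y\to\mathbb R^+$ the empirical maximum mean discrepancy is $$D_{\mathrm{MMD},f,n}(r)=\sup_{g\in\mathcal G}\frac1{n(n-1)}\sum_{1\le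 i\ne j\le n}\big[g(V_i,f(X_j))-r(V_i,f(X_i))g(V_i,f(X_i))\big].$$ The estimated ratio $r_n\ge0$ is computed from $S_n$ as a minimizer over nonnegative functions $r$ of $D_{\mathrm{MMD},f,n}(r)+\Omega(r)$, where $\Omega$ is a regularizer term (possibly zero). The empirical divergence is $D_{\phi,n}(f)=\frac1n\sum_{i=1}^n\phi(r_n(V_i,f(X_i)))$. *)

(* Defs.v *)
From HB Require Import structures.
From mathcomp Require Import all_boot all_order all_algebra.
From mathcomp Require Import all_classical all_reals all_analysis.
Set Implicit Arguments.
Unset Strict Implicit.
Unset Printing Implicit Defensive.
Import Order.TTheory GRing.Theory Num.Theory.
Import numFieldNormedType.Exports.

Local Open Scope classical_set_scope.
Local Open Scope charge_scope.
Local Open Scope ring_scope.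

(* The finite set of labels {1, ..., c0} with c0 = k.+1, numbered from 0, with
   the discrete sigma-algebra.  There is at least one label because measurable
   types are inhabited. *)
Definition label (k : nat) : Type := 'I_k.+1.

HB.instance Definition _ (k : nat) := Finite.on (label k).
HB.instance Definition _ (k : nat) := isPointed.Build (label k) (ord0 : 'I_k.+1).
HB.instance Definition _ (k : nat) :=
  @isMeasurable.Build default_measure_display (label k) discrete_measurable
    discrete_measurable0 discrete_measurableC discrete_measurableU.

Notation borel V := (g_sigma_algebraType (@open V)).

Section laws.
Context (R : realType) (V : ptopologicalType) (dW : measure_display)
  (W : measurableType dW) (k : nat).
Local Notation X := (borel V * W)%type.
Local Notation Y := (label k).

Definition viewpoint (z : X * Y) : borel V := z.1.1.

Definition predicted (f : {mfun X >-> Y}) (z : X * Y) : Y := f z.1.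

Definition view_pred (f : {mfun X >-> Y}) (z : X * Y) : borel V * Y :=
  (viewpoint z, predicted f z).

Lemma measurable_viewpoint : measurable_fun [set: X * Y] viewpoint.
Proof. exact: measurableT_comp measurable_fst measurable_fst. Qed.

Lemma measurable_predicted f : measurable_fun [set: X * Y] (predicted f).
Proof.
by apply: measurableT_comp measurable_fst; exact: measurable_funPT.
Qed.

Lemma measurable_view_pred f : measurable_fun [set: X * Y] (view_pred f).
Proof.
exact: measurable_fun_pair measurable_viewpoint (measurable_predicted f).
Qed.

HB.instance Definition _ := isMeasurableFun.Build _ _ _ _
  viewpoint measurable_viewpoint.
HB.instance Definition _ f := isMeasurableFun.Build _ _ _ _
  (predicted f) (measurable_predicted f).
HB.instance Definition _ f := isMeasurableFun.Build _ _ _ _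
  (view_pred f) (measurable_view_pred f).

Variables (mu : probability (X * Y)%type R) (f : {mfun X >-> Y}).

(* P_{V,f(X)} *)
Definition joint_law : probability (borel V * Y)%type R :=
  distribution mu (view_pred f).

(* P_V (x) P_{f(X)} *)
Definition product_law : probability (borel V * Y)%type R :=
  (distribution mu viewpoint \x distribution mu (predicted f))%E.

(* r is a nonnegative, real-valued measurable version of
   d(P_V (x) P_{f(X)}) / dP_{V,f(X)}.  The library's derivative is meaningful
   only under product_law `<< joint_law. *)
Definition is_prob_ratio (r : V * Y -> R) : Prop :=
  [/\ forall p, 0 <= r p,
      measurable_fun [set: borel V * Y] (r : borel V * Y -> R) &
      ae_eq joint_law [set: borel V * Y] (EFin \o r)
        ('d (charge_of_finite_measure product_law) '/d joint_law)].

(* D_phi(f), given (a version of) the probability ratio r. *)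
Definition phi_dependency (phi : R -> R) (r : V * Y -> R) : \bar R :=
  \int[joint_law]_p (phi (r p))%:E.

End laws.

Section iid.
Context (R : realType) (d0 d : measure_display) (T0 : measurableType d0)
  (T : measurableType d) (P : probability T0 R) (n : nat)
  (Z : 'I_n -> {RV P >-> T}).

Definition mutually_independent : Prop :=
  forall (J : {set 'I_n}) (A : 'I_n -> set T), (forall i, measurable (A i)) ->
    P [set w | forall i, i \in J -> A i (Z i w)] =
    (\prod_(i in J) P (Z i @^-1` A i))%E.

Definition iid_with_law (mu : probability T R) : Prop :=
  mutually_independent /\
  forall i A, measurable A -> distribution P (Z i) A = mu A.

End iid.

Section empirical.
Context (R : realType) (V W : Type) (k n : nat).
Local Notation X := (V * W)%type.
Local Notation Y := (label k).
Variables (f : X -> Y) (S : 'I_n -> X * Y).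

Let view i := (S i).1.1.
Let pred i := f (S i).1.

Definition mmd_stat (r g : V * Y -> R) : R :=
  (n%:R * n.-1%:R)^-1 *
  \sum_(i < n) \sum_(j < n | i != j)
    (g (view i, pred j) - r (view i, pred i) * g (view i, pred i)).

(* D_{MMD,f,n}(r); extended-real valued since the supremum may be infinite. *)
Definition mmd (G : set (V * Y -> R)) (r : V * Y -> R) : \bar R :=
  ereal_sup [set (mmd_stat r g)%:E | g in G].

(* r minimizes D_{MMD,f,n} + Omega over the nonnegative functions. *)
Definition is_ratio_estimate (G : set (V * Y -> R))
    (Omega : (V * Y -> R) -> \bar R) (r : V * Y -> R) : Prop :=
  (forall p, 0 <= r p) /\
  forall r' : V * Y -> R, (forall p, 0 <= r' p) ->
    (mmd G r + Omega r <= mmd G r' + Omega r')%E.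

(* D_{phi,n}(f), given the estimated ratio r. *)
Definition emp_phi_dependency (phi : R -> R) (r : V * Y -> R) : R :=
  n%:R^-1 * \sum_(i < n) phi (r (view i, pred i)).

End empirical.

Section divergence_function.
Context (R : realType) (phi : R -> R).

(* The subdifferential at u of phi, seen as a function on [0, +oo[. *)
Definition subdifferential (u : R) : set R :=
  [set s | forall v, 0 <= v -> phi u + s * (v - u) <= phi v].

(* Functions on R^+ = [0, +oo[ are encoded as functions on R, whose values at
   negative arguments are irrelevant.  Differentiability and the existence of
   subgradients are required at positive points only, so that u |-> u ln u
   (with value 0 at 0), whose subdifferential at 0 is empty, is allowed. *)
Definition divergence_function : Prop :=
  [/\ convex_function (`[0, +oo[%classic : set R) phi,
      lower_semicontinuous (EFin \o phi : subspace `[0, +oo[%classic -> \bar R),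
      phi 1 = 0,
      forall u, 0 < u -> u != 1 -> derivable phi u 1 &
      subdifferential 1 0].

Definition subgradient_choice (dphi : R -> R) : Prop :=
  forall u, 0 < u -> subdifferential u (dphi u).

End divergence_function.

(* Main.v *)
(** Write r for the true ratio.  By the subgradient inequality at r and the
    membership of (dphi o r) / a in G, the sum of the empirical divergence and of
    a times the empirical MMD dominates the U-statistic with kernel
    [U z z' = h (v, f x) + dphi (r (v, f x'))], where
    [h = phi o r - r (dphi o r)]; by the Radon-Nikodym theorem, the expectation of
    U over two independent points is the divergence.  Since dphi is nondecreasing
    and [u |-> phi u - u (dphi u)] is nonincreasing, U ranges in an interval of
    length at most c.  The lower deviation of the U-statistic is bounded as in
    Hoeffding's work: it is an average, over the permutations of the sample, of
    means of n/2 terms depending on disjoint pairs, so that by Jensen's inequality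
    its exponential moments are at most those of one such mean.  As the labels are
    finite, [exp (U z z')] is a finite sum of products of a function of z and a
    function of z', so independence is only needed for products of functions of
    one sample each. *)

Require Import Defs.
From HB Require Import structures.
From mathcomp Require Import all_boot all_order all_algebra fingroup perm.
From mathcomp Require Import all_classical all_reals all_analysis.
From mathcomp Require Import measurable_realfun.
From mathcomp Require Import zify ring lra.
Set Implicit Arguments.
Unset Strict Implicit.
Unset Printing Implicit Defensive.
Import Order.TTheory GRing.Theory Num.Theory.
Import numFieldNormedType.Exports.

Local Open Scope classical_set_scope.
Local Open Scope ring_scope.

(** * Independence *)

Section factor.
Import HBNNSimple.
Local Open Scope ereal_scope.
Context {R : realType} {d0 d : measure_display} {T0 : measurableType d0}
  {T : measurableType d}.
Variables (P : {measure set T0 -> \bar R}) (mu : {measure set T -> \bar R}).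
Variables (X : T0 -> T) (Q : T0 -> R) (q : R).
Hypotheses (mX : measurable_fun setT X) (mQ : measurable_fun setT Q).
Hypothesis Q0 : forall w, (0 <= Q w)%R.
Hypothesis XQ : forall A, measurable A ->
  \int[P]_w (\1_A (X w) * Q w)%:E = mu A * q%:E.

(** [XQ] expresses that [X], of law [mu], is independent of the weight [Q], tested on indicators
    only. Both sides are linear and continuous along increasing sequences in [g], so simple
    functions and monotone convergence extend it. *)
Lemma integral_indep_factor (g : T -> R) : measurable_fun setT g ->
  (forall x, 0 <= g x)%R ->
  \int[P]_w (g (X w) * Q w)%:E = \int[mu]_x (g x)%:E * q%:E.
Proof.
move=> mg g0.
have /measurable_EFinP mg' := mg.
pose g_ := nnsfun_approx measurableT mg'.
have mgX n : measurable_fun setT (g_ n \o X) by apply: measurableT_comp.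
have cg x : (g_ n x)%:E @[n --> \oo] --> (g x)%:E.
  by apply: (@cvg_nnsfun_approx _ _ _ _ measurableT _ mg') => // y _; rewrite lee_fin.
transitivity (limn (fun n => \int[P]_w (g_ n (X w) * Q w)%:E)).
  rewrite -monotone_convergence//.
  - apply: eq_integral => w _; apply/esym/cvg_lim => //.
    have Qfin : (Q w)%:E \is a fin_num by [].
    by rewrite EFinM; exact: (cvgeZr Qfin (cg (X w))).
  - by move=> n; apply/measurable_EFinP; apply: (measurable_funM (mgX n)).
  - by move=> n w _; rewrite lee_fin mulr_ge0.
  - move=> w _ m n mn; rewrite lee_fin ler_wpM2r//.
    exact/lefP/nd_nnsfun_approx.
transitivity (limn (fun n => \int[mu]_x (g_ n x)%:E * q%:E)); last first.
  apply/cvg_lim => //; apply: cvgeZr => //.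
  have -> : \int[mu]_x (g x)%:E = \int[mu]_x limn (fun n => (g_ n x)%:E).
    by apply: eq_integral => x _; apply/esym/cvg_lim => //; exact: cg.
  apply: cvg_monotone_convergence => //.
  - by move=> n; exact/measurable_EFinP/measurable_funP.
  - by move=> n y _; rewrite lee_fin.
  - by move=> y _ m n mn; rewrite lee_fin; exact/lefP/nd_nnsfun_approx.
apply: congr_lim; apply/funext => n.
have mA k : measurable (g_ n @^-1` [set k]) by exact: measurable_sfunP.

have gE x : (g_ n x = \sum_(k \in range (g_ n)) k * \1_(g_ n @^-1` [set k]) x)%R.
  by rewrite [LHS]fimfunE.
pose s := finmap.enum_fset (fset_set (range (g_ n))).
have {}gE x : (g_ n x = \sum_(k <- s) k * \1_(g_ n @^-1` [set k]) x)%R.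
  by rewrite gE fsbig_finite.
have mQk k : measurable_fun setT (fun w => \1_(g_ n @^-1` [set k]) (X w) * Q w)%R.
  by apply: measurable_funM => //; apply: measurableT_comp.
have gk0 k x : (0 <= k * \1_(g_ n @^-1` [set k]) x)%R.
  by rewrite -lee_fin EFinM nnfun_muleindic_ge0.
under [in LHS]eq_integral => w _.
  rewrite gE mulr_suml -sumEFin; over.
under [in RHS]eq_integral => w _.
  rewrite gE -sumEFin; over.
rewrite ge0_integral_sum//; last 2 first.
- move=> k; apply/measurable_EFinP; under eq_fun do rewrite -mulrA.
  exact: measurable_funM.
- by move=> k w _; rewrite lee_fin mulr_ge0.
rewrite ge0_integral_sum//; last 2 first.
- by move=> k; apply/measurable_EFinP; apply: measurable_funM.
- by move=> k w _; rewrite lee_fin.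
rewrite ge0_sume_distrl; last by move=> k _; apply: integral_ge0 => x _; rewrite lee_fin.
apply: eq_bigr => k _.
(* A negative [k] is not a value of the nonnegative simple function: its preimage is empty and both
   sides vanish. For [k >= 0] the scalar leaves the integrals. *)
have [k0|k0] := leP 0%R k; last first.
  rewrite preimage_nnfun0// indic0/=.
  rewrite integral0_eq; last by move=> w _; rewrite mulr0 mul0r.
  by rewrite integral0_eq ?mul0e// => x _; rewrite mulr0.
under [in LHS]eq_integral do rewrite -mulrA EFinM.
rewrite ge0_integralZl//; last 2 first.
- by apply/measurable_EFinP; exact: mQk.
- by move=> x _; rewrite lee_fin mulr_ge0.
rewrite XQ// muleA; congr (_ * _).
under [in RHS]eq_integral do rewrite EFinM.
rewrite ge0_integralZl//; last exact/measurable_EFinP.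
by rewrite integral_indic ?setIT.
Qed.

End factor.

Section independence.
Local Open Scope ereal_scope.
Context {R : realType} {d0 d : measure_display} {T0 : measurableType d0}
  {T : measurableType d}.
Variables (P : probability T0 R) (mu : probability T R).
Variables (I : finType) (X : I -> T0 -> T).
Hypothesis mX : forall i, measurable_fun setT (X i).
Hypothesis indX : forall A : I -> set T, (forall i, measurable (A i)) ->
  P (\bigcap_i X i @^-1` A i) = \prod_i mu (A i).

Lemma integral_indep_prod (g : I -> T -> R) (c : I -> R) :
  (forall i, measurable_fun setT (g i)) -> (forall i x, (0 <= g i x)%R) ->
  (forall i, \int[mu]_x (g i x)%:E = (c i)%:E) ->
  \int[P]_w (\prod_i g i (X i w))%:E = (\prod_i c i)%:E.
Proof.
(* Indicators are replaced by arbitrary functions one coordinate at a time. *)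
suff H (s : seq I) : forall (g : I -> T -> R) (c : I -> R),
    (forall i, measurable_fun setT (g i)) -> (forall i x, (0 <= g i x)%R) ->
    (forall i, \int[mu]_x (g i x)%:E = (c i)%:E) ->
    (forall i, i \notin s -> exists2 A, measurable A & g i = \1_A) ->
    \int[P]_w (\prod_i g i (X i w))%:E = (\prod_i c i)%:E.
  move=> mg g0 gc; apply: (H (enum I)) => // i.
  by rewrite mem_enum.
elim: s => [|j s IH] {}g {}c mg g0 gc gA.
  have /choice[A HA] : forall i, exists A, measurable A /\ g i = \1_A.
    by move=> i; have [//|A] := gA i; exists A.
  have mA i : measurable (A i) by case: (HA i).
  have mXA i : measurable (X i @^-1` A i).
    by rewrite -[X in measurable X]setTI; exact: mX.
  transitivity (\int[P]_w (\1_(\bigcap_i X i @^-1` A i) w)%:E).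
    apply: eq_integral => w _; congr EFin.
    under eq_bigr => i _ do rewrite (HA i).2 indicE.
    rewrite indicE; have [wA|wA] := boolP (w \in _).
      apply: big1 => i _; move: wA; rewrite inE => /(_ i Logic.I) wA.
      by rewrite mem_set.
    have [i wAi] : exists i, X i w \notin A i.
      apply/not_existsP => nA; move/negP: wA; apply; rewrite inE => i _.
      by have /negP := nA i; rewrite negbK inE.
    by rewrite (bigD1 i)//= (negbTE wAi) mul0r.
  rewrite integral_indic//; last exact: fin_bigcap_measurable.
  rewrite setIT; transitivity (\prod_i mu (A i)); first exact: indX.
  rewrite -prodEFin; apply: eq_bigr => i _.
  by rewrite -gc (HA i).2 integral_indic// setIT.
have mgX i : measurable_fun setT (g i \o X i) by apply: measurableT_comp.
under eq_integral => w _ do rewrite (bigD1 j)//=.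
rewrite (bigD1 j)//= EFinM -gc.
apply: (integral_indep_factor
  (Q := fun w => (\prod_(i | i != j) g i (X i w))%R)) => //.
- under eq_fun do rewrite -big_filter.
  by apply: measurable_prod => i _; exact: mgX.
- by move=> w; apply: prodr_ge0.
move=> A mA.
(* With an indicator at coordinate [j], the only coordinates left that may not be indicators are in
   [s], so the induction hypothesis applies. *)
pose g' i := if i == j then \1_A else g i.
pose c' i := if i == j then fine (mu A) else c i.
have -> : mu A * (\prod_(i | i != j) c i)%:E = (\prod_i c' i)%:E.
  rewrite [in RHS](bigD1 j)//= {1}/c' eqxx EFinM fineK ?fin_num_measure//.
  by congr (_ * _%:E); apply: eq_bigr => i /negbTE; rewrite /c' => ->.
rewrite -(IH g' c').
- apply: eq_integral => w _.
  rewrite [in RHS](bigD1 j)//= {1}/g' eqxx; congr (_ * _)%:E.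
  by apply: eq_bigr => i /negbTE; rewrite /g' => ->.
- by move=> i; rewrite /g'; case: eqP.
- by move=> i x; rewrite /g'; case: eqP.
- move=> i; rewrite /g' /c'; case: eqP => // _.
  by rewrite integral_indic// setIT fineK ?fin_num_measure.
- move=> i si; rewrite /g'; case: eqP => [_|/eqP ij]; first by exists A.
  by apply: gA; rewrite inE negb_or ij.
Qed.

End independence.

(** * Hoeffding's lemma and U-statistics *)

Section hoeffding_scalar.
Context {R : realType} (p : R).
Hypotheses (p0 : 0 <= p) (p1 : p <= 1).

(** The moment generating function of a Bernoulli variable of parameter [p]. *)
Let q (s : R) := 1 - p + p * expR s.

Let q_gt0 s : 0 < q s.
Proof.
rewrite /q; have := expR_gt0 s => e0.
have [->|pn1] := eqVneq p 1; first by lra.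
have : p < 1 by rewrite lt_neqAle pn1.
have := mulr_ge0 p0 (ltW e0); lra.
Qed.

Let dq s : is_derive s (1 : R) q (p * expR s).
Proof.
rewrite /q; apply: is_derive_eq.
by rewrite /GRing.scale/=; ring.
Qed.

Let G (s : R) := p + s / 4 - p * expR s * (q s)^-1.

Let dG s : is_derive s (1 : R) G (4^-1 - p * expR s * (1 - p) / (q s) ^+ 2).
Proof.
have q0 : q s != 0 by rewrite gt_eqF.
have := dq s => dqs.
rewrite /G; apply: is_derive_eq.
rewrite /GRing.scale/=.
have -> : p * expR s = q s - (1 - p) by rewrite /q; ring.
by field.
Qed.

Let F (s : R) := p * s + s ^+ 2 / 8 - ln (q s).

Let dF s : is_derive s (1 : R) F (G s).
Proof.
have q0 := q_gt0 s.
have := dq s => dqs.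
have := is_derive1_comp (is_derive1_ln q0) dqs => dlq.
rewrite /F; apply: is_derive_eq.
rewrite /GRing.scale/= /G.
by field; rewrite gt_eqF.
Qed.

Let is_derive_ge0_le (f g : R -> R) (b : R) : (forall x, is_derive x (1 : R) f (g x)) ->
  (forall x, 0 <= x -> 0 <= g x) -> 0 <= b -> f 0 <= f b.
Proof.
move=> fg g0 b0.
have df x : derivable f x 1 by apply: ex_derive.
apply: (@ger0_derive1_le_cc _ f 0 b) => //.
- move=> x; rewrite in_itv/= => /andP[x0 _].
  by rewrite derive1E derive_val g0 // ltW.
- apply: continuous_subspaceT => x.
  exact/differentiable_continuous/derivable1_diffP.
- by rewrite in_itv/= lexx.
- by rewrite in_itv/= lexx andbT.
Qed.

(** The logarithmic gap [F] and its derivative [G] both vanish at 0, and the derivative of [G] is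
    nonnegative because [4 * x * y <= (x + y) ^+ 2] with [x = 1 - p] and [y = p * expR s]. *)
Lemma bernoulli_mgf_le (s : R) : 0 <= s ->
  1 - p + p * expR s <= expR (p * s + s ^+ 2 / 8).
Proof.
move=> s0.
have G0 x : 0 <= x -> 0 <= G x.
  move=> x0; have -> : 0 = G 0.
    by rewrite /G /q expR0 !mulr1 subrK invr1 mul0r; ring.
  apply: (is_derive_ge0_le dG) => // y _.
  rewrite subr_ge0 ler_pdivrMr ?exprn_gt0// /q.
  have := sqr_ge0 (1 - p - p * expR y); lra.
have : F 0 <= F s by exact: (is_derive_ge0_le dF).
rewrite /F/= /q expR0 mulr1 subrK ln1 => F0.
rewrite -ler_ln ?posrE ?expR_gt0 //; last exact: q_gt0.
by rewrite expRK; rewrite /q in F0; lra.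
Qed.

End hoeffding_scalar.

(** * Averages over permutations *)

Section permutation_average.
Context {R : comPzRingType} {n : nat}.
Implicit Types (a b : 'I_n) (U : 'I_n -> 'I_n -> R).

Lemma sum_off_diagonal (F : 'I_n -> R) :
  \sum_(i < n) \sum_(j < n | i != j) F i = n.-1%:R * \sum_(i < n) F i.
Proof.
rewrite mulr_sumr; apply: eq_bigr => i _.
rewrite sumr_const (eq_card (B := predC1 i)) ?cardC1 ?card_ord ?mulr_natl// => j.
by rewrite !inE eq_sym.
Qed.

Lemma perm_pair_transitive a b a' b' : a != b -> a' != b' ->
  exists s : 'S_n, s a = a' /\ s b = b'.
Proof.
move=> ab ab'; pose b1 := tperm a a' b.
(* The first transposition sends [a] to [a'] and [b] to [b1]; the second sends [b1] to [b'] and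
   fixes [a'], which differs from both. *)
exists (tperm a a' * tperm b1 b')%g; rewrite !permM tpermL tpermL; split=> //.
rewrite tpermD//; last by rewrite eq_sym.
by rewrite /b1 -[X in _ != X](tpermL a a') (inj_eq perm_inj) eq_sym.
Qed.

(** By double transitivity the sum over permutations is the same for every pair of distinct indices.
    Summing it over all such pairs and exchanging the sums, each permutation merely reindexes the
    off-diagonal sum. *)
Lemma sum_perm_pair U a b : a != b ->
  (n * n.-1)%:R * \sum_(s : 'S_n) U (s a) (s b) =
  (n`!)%:R * \sum_(i < n) \sum_(j < n | i != j) U i j.
Proof.
move=> ab; pose S a b := \sum_(s : 'S_n) U (s a) (s b).
have SE a' b' : a' != b' -> S a' b' = S a b.
  move=> ab'; have [r [ra rb]] := perm_pair_transitive ab ab'.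
  rewrite /S [RHS](reindex_inj (mulgI r)).
  by apply: eq_bigr => s _; rewrite !permM ra rb.
transitivity (\sum_(i < n) \sum_(j < n | i != j) S i j).
  rewrite -[LHS]/(_ * S a b) natrM -mulrA mulrCA.
  have -> : n%:R * S a b = \sum_(i < n) S a b.
    by rewrite sumr_const card_ord mulr_natl.
  rewrite -sum_off_diagonal.
  by apply: eq_bigr => i _; apply: eq_bigr => j ij; rewrite SE.
rewrite /S; under eq_bigr do rewrite exchange_big/=.
rewrite exchange_big/= mulr_natl.
rewrite (eq_bigr (fun=> \sum_(i < n) \sum_(j < n | i != j) U i j)).
  by rewrite sumr_const -card_Sn.
move=> s _; rewrite [RHS](reindex_inj (@perm_inj _ s)); apply: eq_bigr => i _.
rewrite [RHS](reindex_inj (@perm_inj _ s)); apply: eq_bigl => j.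
by rewrite (inj_eq perm_inj).
Qed.

End permutation_average.

(** Jensen's inequality: the exponential lies above its tangent at the mean [M], and the linear
    terms cancel in the sum. *)
Lemma expR_mean_le {R : realType} {I : finType} (x : I -> R) : (0 < #|I|)%N ->
  expR (#|I|%:R^-1 * \sum_i x i) <= #|I|%:R^-1 * \sum_i expR (x i).
Proof.
move=> I0; set M := _ * \sum_i x i.
have N0 : (0 : R) < #|I|%:R by rewrite ltr0n.
rewrite mulrC ler_pdivlMr//.
apply: (@le_trans _ _ (\sum_i expR M * (1 + (x i - M)))).
  rewrite -mulr_sumr ler_pM2l ?expR_gt0// !big_split/= !sumrN !sumr_const.
  by rewrite -[M *+ _]mulr_natl /M mulVKf ?gt_eqF// subrr addr0.
apply: ler_sum => i _.
by rewrite -[x i in leRHS](subrKC M) expRD ler_pM2l ?expR_gt0// expR_ge1Dx.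
Qed.

Lemma integral_probability_cst {R : realType} {d : measure_display}
    {T : measurableType d} (P : probability T R) (r : R) :
  (\int[P]_w r%:E = r%:E)%E.
Proof.
transitivity (r%:E * P setT)%E; first exact: integral_cst.
by rewrite probability_setT mule1.
Qed.

Section hoeffding_lemma.
Context {R : realType} {d : measure_display} {T : measurableType d}.
Variables (P : probability T R) (X : T -> R) (al be : R).
Hypotheses (mX : measurable_fun setT X) (Xb : forall w, al <= X w <= be).

Lemma integrable_bounded_prob : P.-integrable setT (EFin \o X).
Proof.
apply: measurable_bounded_integrable => //.
  by rewrite (le_lt_trans (probability_le1 _ _))// ltry.
exists (`|al| + `|be|); split=> [|M abM w _]; first by rewrite num_real.
have /andP[aX Xbe] := Xb w; apply/ltW/(le_lt_trans _ abM).
rewrite /= ler_norml; apply/andP; split.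
  by have := ler_norm (- al); rewrite normrN; have := normr_ge0 be; lra.
by have := ler_norm be; have := normr_ge0 al; lra.
Qed.

(** By convexity the exponential lies below its chord on [[al, be]]. As [X] is centered, the mean of
    the chord is its value at 0, a Bernoulli moment generating function up to the factor
    [expR (s * al)]. *)
Lemma hoeffding_lemma (s : R) : 0 <= s -> (\int[P]_w (X w)%:E = 0)%E ->
  (\int[P]_w (expR (s * X w))%:E <= (expR (s ^+ 2 * (be - al) ^+ 2 / 8))%:E)%E.
Proof.
move=> s0 EX0; have iX := integrable_bounded_prob.
have iC (r : R) : P.-integrable setT (fun=> r%:E).
  exact: finite_measure_integrable_cst.
have EC (r : R) := integral_probability_cst P r.
have al0 : al <= 0.
  have : (\int[P]_w al%:E <= \int[P]_w (X w)%:E)%E.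
    by apply: le_integral => // w _; rewrite lee_fin; case/andP: (Xb w).
  by rewrite EC EX0 lee_fin.
have be0 : 0 <= be.
  have : (\int[P]_w (X w)%:E <= \int[P]_w be%:E)%E.
    by apply: le_integral => // w _; rewrite lee_fin; case/andP: (Xb w).
  by rewrite EC EX0 lee_fin.
have [albe|albe] := eqVneq al be.
  have a0 : al = 0 by apply/eqP; rewrite eq_le al0 albe be0.
  rewrite -albe subrr expr0n/= mulr0 mul0r expR0 -EC.
  rewrite le_eqVlt; apply/orP; left; apply/eqP; apply: eq_integral => w _.
  have X0 : X w = 0.
    by apply/eqP; rewrite eq_le; have := Xb w; rewrite -albe a0 andbC.
  by rewrite X0 mulr0 expR0.
have ab : 0 < be - al.
  by rewrite subr_gt0 lt_neqAle albe (le_trans al0 be0).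
(* The weight of [be] in the centered law carried by [al] and [be]; below, [k] is the slope of the
   chord and [r] its value at 0. *)
pose p := - al / (be - al).
have p0 : 0 <= p by rewrite divr_ge0 ?oppr_ge0// ltW.
have p1 : p <= 1 by rewrite /p ler_pdivrMr// mul1r; lra.
pose k := (expR (s * be) - expR (s * al)) / (be - al).
pose r := expR (s * al) * (1 - p + p * expR (s * (be - al))).
have chord w : expR (s * X w) <= r + k * X w.
  have [aX Xbe] := andP (Xb w).
  pose x := (X w - al) / (be - al).
  have x01 : 0 <= x <= 1.
    apply/andP; split; first by rewrite divr_ge0 ?(ltW ab) ?subr_ge0.
    by rewrite ler_pdivrMr // mul1r lerB.
  have := @convex_expR R (Itv01 (proj1 (andP x01)) (proj2 (andP x01)))
    (s * be) (s * al).
  rewrite !convRE/= /unstable.onem => H.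
  have e1 : s * X w = x * (s * be) + (1 - x) * (s * al).
    by rewrite /x; field; rewrite gt_eqF.
  rewrite e1 (le_trans H)// /r /k /p le_eqVlt; apply/orP; left; apply/eqP.
  have -> : s * (be - al) = s * be - s * al by ring.
  rewrite expRD expRN /x; have := expR_gt0 (s * al).
  move: (expR (s * al)) (expR (s * be)) => a b a_gt0.
  by field; rewrite !gt_eqF.
apply: (@le_trans _ _ (\int[P]_w (r%:E + k%:E * (X w)%:E))%E).
  apply: ge0_le_integral => //.
  - apply/measurable_EFinP; apply: measurableT_comp => //.
    exact: measurable_funM.
  - apply/measurable_EFinP; apply: measurable_funD => //.
    exact: measurable_funM.
  - by move=> w _; rewrite lee_fin.
rewrite integralD//; last exact: integrableZl.
rewrite EC integralZl// EX0 mule0 adde0 lee_fin.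
rewrite /r; apply: (@le_trans _ _ (expR (s * al) *
  expR (p * (s * (be - al)) + (s * (be - al)) ^+ 2 / 8))).
  by rewrite ler_pM2l ?expR_gt0//; apply: bernoulli_mgf_le => //; rewrite mulr_ge0// ltW.
rewrite -expRD ler_expR /p le_eqVlt; apply/orP; left; apply/eqP.
by field; rewrite gt_eqF.
Qed.

End hoeffding_lemma.

(** * Products over disjoint pairs of i.i.d. samples *)

Section iid_samples.
Context {R : realType} {d0 d : measure_display} {T0 : measurableType d0}
  {T : measurableType d}.
Variables (P : probability T0 R) (mu : probability T R) (n : nat)
  (Z : 'I_n -> {RV P >-> T}).
Hypothesis Z_iid : iid_with_law Z mu.

Lemma iid_subfamily (I : finType) (p : I -> 'I_n) : injective p ->
  forall A : I -> set T, (forall i, measurable (A i)) ->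
  P (\bigcap_i Z (p i) @^-1` A i) = (\prod_i mu (A i))%E.
Proof.
move=> p_inj A mA.
(* The events are transported along [p]; injectivity makes the picked preimage the right one. *)
pose A' j := if [pick i | p i == j] is Some i then A i else setT.
have A'E i : A' (p i) = A i.
  rewrite /A'; case: pickP => [i' /eqP/p_inj -> //|/(_ i)].
  by rewrite eqxx.
have mA' j : measurable (A' j) by rewrite /A'; case: pickP.
have := Z_iid.1 [set j in codom p]%SET A' mA'.
rewrite (_ : [set w | _] = \bigcap_i Z (p i) @^-1` A i); last first.
  apply/seteqP; split=> [w Aw i _|w Aw j].
    by rewrite /= -A'E; apply: Aw; rewrite inE codom_f.
  by rewrite inE => /codomP[i ->]; rewrite A'E; exact: Aw.
move=> ->.
transitivity (\prod_(j in p @: [set: I]%SET) P (Z j @^-1` A' j))%E.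
  apply: eq_bigl => j; rewrite inE; apply/codomP/imsetP => [[i ->]|[i _ ->]].
    by exists i; rewrite ?inE.
  by exists i.
rewrite big_imset/=; last by move=> i j _ _; exact: p_inj.
under eq_bigl do rewrite inE.
by apply: eq_bigr => i _; rewrite A'E -(Z_iid.2 (p i)).
Qed.

(** Expanding the product of sums gives one term per choice of a summand for each pair. Each term is
    a product of functions of distinct samples, so its integral factors, and the expansion is then
    folded back. *)
Lemma integral_iid_pairs (L : finType) (alpha beta : L -> T -> R) (a b : L -> R)
    (m : nat) (p : 'I_m * bool -> 'I_n) : injective p ->
  (forall l, measurable_fun setT (alpha l)) ->
  (forall l, measurable_fun setT (beta l)) ->
  (forall l x, 0 <= alpha l x) -> (forall l x, 0 <= beta l x) ->
  (forall l, \int[mu]_x (alpha l x)%:E = (a l)%:E)%E ->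
  (forall l, \int[mu]_x (beta l x)%:E = (b l)%:E)%E ->
  (\int[P]_w (\prod_(k < m) \sum_l
     (alpha l (Z (p (k, false)) w) * beta l (Z (p (k, true)) w)))%:E =
  ((\sum_l a l * b l) ^+ m)%:E)%E.
Proof.
move=> p_inj malpha mbeta alpha0 beta0 aE bE.
pose g (l : {ffun 'I_m -> L}) (i : 'I_m * bool) : T -> R :=
  if i.2 then beta (l i.1) else alpha (l i.1).
pose c (l : {ffun 'I_m -> L}) (i : 'I_m * bool) : R :=
  if i.2 then b (l i.1) else a (l i.1).
have mg l i : measurable_fun setT (g l i) by rewrite /g; case: ifP.
have g0 l i x : 0 <= g l i x by rewrite /g; case: ifP.
have gc l i : (\int[mu]_x (g l i x)%:E = (c l i)%:E)%E.
  by rewrite /g /c; case: ifP.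
have split_pair (F : 'I_m * bool -> R) :
    \prod_i F i = \prod_(k < m) (F (k, false) * F (k, true)).
  rewrite (eq_bigr (fun i => F (i.1, i.2))) => [|[]//].
  rewrite -(pair_bigA _ (fun k b => F (k, b)))/=.
  by apply: eq_bigr => k _; rewrite big_bool mulrC.
transitivity (\int[P]_w (\sum_l (\prod_i g l i (Z (p i) w))%:E))%E.
  apply: eq_integral => w _; rewrite bigA_distr_bigA/= sumEFin.
  by congr EFin; apply: eq_bigr => l _; rewrite split_pair.
rewrite ge0_integral_sum//; last 2 first.
- move=> l; apply/measurable_EFinP; apply: measurable_prod => i _.
  by apply: measurableT_comp.
- by move=> l w _; rewrite lee_fin prodr_ge0.
transitivity (\sum_l (\prod_i c l i)%:E)%E.
  apply: eq_bigr => l _.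
  apply: (integral_indep_prod (X := fun i => Z (p i)) _ _ (mg l) (g0 l) (gc l)) => //.
  exact: iid_subfamily.
rewrite sumEFin; congr EFin.
under eq_bigr do rewrite split_pair.
rewrite -(bigA_distr_bigA (fun (k : 'I_m) l => a l * b l)) prodr_const card_ord.
by [].
Qed.

End iid_samples.

(** * Concentration of U-statistics *)

Section ustat.
Context {R : realType} {d : measure_display} {T : measurableType d}.
Variables (P : probability T R) (n : nat) (n_ge2 : (2 <= n)%N).
Variables (U : 'I_n -> 'I_n -> T -> R) (c D : R).
Hypothesis mU : forall i j, measurable_fun setT (U i j).
(** The bound satisfied by a product over [n./2] independent pairs when Hoeffding's lemma holds for
    each with range [c]. *)
Hypothesis U_mgf : forall (p : 'I_n./2 * bool -> 'I_n) (s : R), injective p ->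
  0 <= s ->
  (\int[P]_w (\prod_(k < n./2) expR (s * (D - U (p (k, false)) (p (k, true)) w)))%:E
   <= (expR (s ^+ 2 * c ^+ 2 / 8 *+ n./2))%:E)%E.

Definition ustat w :=
  (n * n.-1)%:R^-1 * \sum_(i < n) \sum_(j < n | i != j) U i j w.

Lemma measurable_ustat : measurable_fun setT ustat.
Proof.
apply: measurable_funM => //; apply: measurable_sum => i.
by under eq_fun do rewrite -big_filter; exact: measurable_sum.
Qed.

(** Splits the indices into consecutive pairs [2k, 2k + 1]; when [n] is odd the last index is left
    out. *)
Definition pair_index (k : 'I_n./2 * bool) : nat := k.1.*2 + k.2.

Lemma pair_index_lt k : (pair_index k < n)%N.
Proof.
have := odd_double_half n; case: k => [k b]; have := ltn_ord k.
by rewrite /pair_index/=; case: b; lia.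
Qed.

Definition pair_ord (s : 'S_n) (k : 'I_n./2 * bool) : 'I_n :=
  s (Ordinal (pair_index_lt k)).

Lemma pair_ord_inj s : injective (pair_ord s).
Proof.
move=> [k b] [k' b'] /perm_inj/(congr1 val); rewrite /= /pair_index/= => kb.
have kk : k = k' :> nat by case: b b' kb => [] [] /=; lia.
by congr pair; [exact: val_inj|case: b b' kb => [] []//=; lia].
Qed.

Let block (s : 'S_n) w :=
  \sum_(k < n./2) (D - U (pair_ord s (k, false)) (pair_ord s (k, true)) w).

(** The two indices of a pair are distinct, so each of the [n./2] terms of a block averages to
    [D - ustat w] over the permutations. *)
Lemma ustat_perm w :
  (n./2)%:R * (D - ustat w) = (#|{perm 'I_n}|)%:R^-1 * \sum_(s : 'S_n) block s w.
Proof.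
have nn0 : (n * n.-1)%:R != 0 :> R by rewrite pnatr_eq0; lia.
have N0 : (n`!)%:R != 0 :> R by rewrite pnatr_eq0 -lt0n fact_gt0.
have -> : #|{perm 'I_n}| = n`! by rewrite -card_Sn; apply: eq_card.
rewrite /block exchange_big/=.
rewrite (eq_bigr (fun=> (n`!)%:R * (D - ustat w))) => [|k _].
  by rewrite sumr_const card_ord -mulrnAr mulKf// mulr_natl.
rewrite sumrB sumr_const mulrBr; congr (_ - _).
  by rewrite mulr_natl -card_Sn; congr (_ *+ _); apply: eq_card.
have ab : Ordinal (pair_index_lt (k, false)) != Ordinal (pair_index_lt (k, true)).
  by apply/eqP => /(congr1 val)/=; rewrite /pair_index/=; lia.
apply: (mulfI nn0); rewrite /ustat mulrCA mulVKf//.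
exact: (sum_perm_pair (fun i j => U i j w) ab).
Qed.

Lemma ustat_concentration (t : R) : 0 < t -> 0 < c ->
  (P [set w | (c * Num.sqrt (2 * t / n%:R) <= D - ustat w)%R] <= (expR (- t))%:E)%E.
Proof.
move=> t0 c0; set e := c * _.
have n0 : 0 < n%:R :> R by rewrite ltr0n; lia.
have e0 : 0 < e by rewrite mulr_gt0// sqrtr_gt0 divr_gt0// mulr_gt0.
have m0 : 0 < (n./2)%:R :> R by rewrite ltr0n; lia.
(* Minimizes the exponent [s ^+ 2 * c ^+ 2 / 8 - s * e] of the Chernoff bound. *)
pose s := 4 * e / c ^+ 2.
have s0 : 0 < s by rewrite divr_gt0 ?exprn_gt0// mulr_gt0.
pose N := #|{perm 'I_n}|.
have N0 : (0 < N)%N by apply/card_gt0P; exists 1%g.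
have mX : measurable_fun setT (fun w => D - ustat w).
  by apply: measurable_funB => //; exact: measurable_ustat.
pose X : {RV P >-> R} := HB.pack (fun w => D - ustat w)
  (isMeasurableFun.Build _ _ _ _ _ mX).
have mb r : measurable_fun setT (block r).
  by apply: measurable_sum => k; exact: measurable_funB.
have me r : measurable_fun setT (fun w => expR (s * block r w)).
  by apply: measurableT_comp => //; exact: measurable_funM.
have sm0 : 0 < s * (n./2)%:R by rewrite mulr_gt0.
(* The factor [n./2] in the Chernoff parameter turns the exponent into the mean over permutations of
   [s * block r w], ready for Jensen's inequality. *)
apply: (le_trans (chernoff X e sm0)).
have mgf : (mmt_gen_fun P X (s * (n./2)%:R) <=
    (expR (s ^+ 2 * c ^+ 2 / 8 *+ n./2))%:E)%E.
  rewrite /mmt_gen_fun unlock.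
  apply: (@le_trans _ _
    (\int[P]_w ((N%:R^-1)%:E * \sum_(r : 'S_n) (expR (s * block r w))%:E))%E).
    apply: ge0_le_integral => //=.
    - apply/measurable_EFinP; apply: measurableT_comp => //.
      exact: measurable_funM.
    - by apply: measurable_funeM; apply: emeasurable_sum => r; exact/measurable_EFinP.
    - move=> w _. rewrite sumEFin lee_fin.
      rewrite mulrC -mulrA ustat_perm mulrCA mulr_sumr.
      exact: expR_mean_le.
  rewrite ge0_integralZl//; last 2 first.
  - by apply: emeasurable_sum => r; exact/measurable_EFinP.
  - by move=> w _; apply: sume_ge0 => r _; rewrite lee_fin expR_ge0.
  rewrite ge0_integral_sum//; last first.
  - by move=> r; exact/measurable_EFinP.
  apply: (@le_trans _ _ ((N%:R^-1)%:E *
    \sum_(r : 'S_n) (expR (s ^+ 2 * c ^+ 2 / 8 *+ n./2))%:E)%E).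
    apply: lee_wpmul2l; first by rewrite lee_fin invr_ge0.
    apply: lee_sum => r _; apply: le_trans (U_mgf (@pair_ord_inj r) (ltW s0)).
    rewrite le_eqVlt; apply/orP; left; apply/eqP; apply: eq_integral => w _.
    by rewrite /block mulr_sumr expR_sum.
  rewrite sumEFin sumr_const -EFinM lee_fin.
  by rewrite -[X in _ * X]mulr_natl mulKf// pnatr_eq0 -lt0n.
apply: (le_trans (lee_wpmul2r _ mgf)); first by rewrite lee_fin expR_ge0.
rewrite -EFinM -expRD lee_fin ler_expR.
have e2 : e ^+ 2 = c ^+ 2 * (2 * t / n%:R).
  by rewrite exprMn sqr_sqrtr// divr_ge0// ?ltW// mulr_gt0.
have -> : s ^+ 2 * c ^+ 2 / 8 *+ n./2 - s * (n./2)%:R * e =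
    - (n./2)%:R * 2 * (e ^+ 2 / c ^+ 2).
  by rewrite -mulr_natr /s; field; rewrite gt_eqF.
rewrite e2 (mulrC (c ^+ 2)) mulfK ?gt_eqF ?exprn_gt0//.
(* The exponent is now [- 4 * t * n./2 / n]. Since [n <= 2 * n./2 + 1] and [n./2 >= 1], it is at
   most [- t]: the 2 under the square root absorbs the rounding of [n / 2]. *)
have n4 : (n%:R : R) <= 4 * (n./2)%:R.
  by rewrite -natrM ler_nat; have := odd_double_half n; case: odd; lia.
rewrite !mulNr lerN2 mulrA ler_pdivlMr//.
apply: (le_trans (ler_wpM2l (ltW t0) n4)).
by rewrite le_eqVlt; apply/orP; left; apply/eqP; ring.
Qed.

End ustat.

(** * Divergence functions *)

Section divergence.
Context {R : realType}.
Variables phi dphi : R -> R.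
Hypotheses (phi1 : phi 1 = 0) (sub1 : subdifferential phi 1 0).
Hypothesis phi_sub : subgradient_choice phi dphi.

Lemma divergence_ge0 u : 0 <= u -> 0 <= phi u.
Proof. by move=> /sub1; rewrite phi1 mul0r addr0. Qed.

(** Add the subgradient inequalities at [u] and at [v], each tested at the other point. *)
Lemma subgradient_le u v : 0 < u -> u <= v -> dphi u <= dphi v.
Proof.
move=> u0 uv; have v0 := lt_le_trans u0 uv.
have [->//|vu] := eqVneq u v.
have d0 : 0 < v - u by rewrite subr_gt0 lt_neqAle vu.
have := phi_sub u0 (ltW v0); have := phi_sub v0 (ltW u0).
move=> h1 h2; rewrite -(ler_pM2r d0); lra.
Qed.

(** [phi u - u * dphi u] is the value at 0 of the supporting line at [u], that is, minus the convex
    conjugate at [dphi u]. *)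
Lemma divergence_conjugate_ge u v : 0 < u -> u <= v ->
  phi v - v * dphi v <= phi u - u * dphi u.
Proof.
move=> u0 uv; have v0 := lt_le_trans u0 uv.
have := phi_sub v0 (ltW u0); have := ler_wpM2l (ltW u0) (subgradient_le u0 uv).
lra.
Qed.

(** As [phi] is minimal at 1, the supporting line at [v < 1], tested at 1, has slope at most 0. Only
    subgradients at [v] are taken, so [u = 0] is allowed. *)
Lemma divergence_nonincreasing u v : 0 <= u -> u <= v -> v <= 1 -> phi v <= phi u.
Proof.
move=> u0 uv v1; have [->|uNv] := eqVneq u v; first by [].
have v0 : 0 < v by rewrite (le_lt_trans u0)// lt_neqAle uNv.
have [->|vN1] := eqVneq v 1; first by rewrite phi1 divergence_ge0.
have v1' : 0 < 1 - v by rewrite subr_gt0 lt_neqAle vN1.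
have dv : dphi v <= 0.
  rewrite -(ler_pM2r v1') mul0r.
  by have := phi_sub v0 ler01; have := divergence_ge0 (ltW v0); rewrite phi1; lra.
have := phi_sub v0 u0; have := mulr_le0_ge0 dv (_ : 0 <= v - u).
by rewrite subr_ge0 => /(_ uv); lra.
Qed.

Lemma divergence_nondecreasing u v : 1 <= u -> u <= v -> phi u <= phi v.
Proof.
move=> u1 uv; have u0 : 0 < u by exact: lt_le_trans u1.
have [->|uN1] := eqVneq u 1.
  by rewrite phi1 divergence_ge0// (le_trans _ (le_trans u1 uv)).
have u1' : 0 < u - 1 by rewrite subr_gt0 lt_neqAle eq_sym uN1.
have du : 0 <= dphi u.
  rewrite -(ler_pM2r u1') mul0r.
  by have := phi_sub u0 ler01; have := divergence_ge0 (ltW u0); rewrite phi1; lra.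
have := phi_sub u0 (le_trans (ltW u0) uv); have := mulr_ge0 du (_ : 0 <= v - u).
by rewrite subr_ge0 => /(_ uv); lra.
Qed.

Lemma measurable_divergence :
  measurable_fun setT (fun u : R => phi (Num.max 0 u)).
Proof.
(* As [phi 1 = 0], phi is the sum of an antitone and of a monotone function. *)
have -> : (fun u : R => phi (Num.max 0 u)) =
    (fun u : R => phi (Num.min 1 (Num.max 0 u))) \+ (fun u : R => phi (Num.max 1 u)).
  apply/funext => u /=; have [u1|u1] := leP u 1.
    by rewrite phi1 addr0 min_r// ge_max ler01.
  by rewrite !max_r ?(ltW (lt_trans ltr01 u1))// min_l ?phi1 ?add0r ?ltW.
apply: measurable_funD.
- apply: nonincreasing_measurable => // u v uv.
  apply: divergence_nonincreasing.
  + by rewrite le_min ler01/= le_max lexx.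
  + by rewrite le_min !ge_min lexx/= ge_max !le_max lexx uv !orbT.
  + by rewrite ge_min lexx.
- apply: nondecreasing_measurable => // u v uv.
  apply: divergence_nondecreasing.
  + by rewrite le_max lexx.
  + by rewrite ge_max le_max lexx/= le_max uv orbT.
Qed.

(** Turns almost sure bounds on the ratio into bounds that hold everywhere. *)
Definition clamp (cl cu u : R) := Num.max cl (Num.min cu u).

Lemma clamp_itv cl cu u : cl <= cu -> cl <= clamp cl cu u <= cu.
Proof. by move=> cc; rewrite /clamp le_max lexx/= ge_max cc ge_min lexx. Qed.

Lemma clamp_id cl cu u : cl <= u <= cu -> clamp cl cu u = u.
Proof. by move=> /andP[cu1 cu2]; rewrite /clamp min_r// max_r. Qed.

Lemma clamp_le cl cu u v : u <= v -> clamp cl cu u <= clamp cl cu v.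
Proof.
move=> uv; rewrite /clamp ge_max le_max lexx/= le_max le_min !ge_min.
by rewrite lexx uv !orbT.
Qed.

Lemma measurable_clamp cl cu : measurable_fun setT (clamp cl cu).
Proof. by apply: nondecreasing_measurable => // u v; exact: clamp_le. Qed.

Lemma measurable_subgradient_clamp cl cu : 0 < cl -> cl <= cu ->
  measurable_fun setT (fun u : R => dphi (clamp cl cu u)).
Proof.
move=> cl0 clcu; apply: nondecreasing_measurable => // u v uv.
apply: subgradient_le; last exact: clamp_le.
by have /andP[+ _] := clamp_itv u clcu; exact: lt_le_trans.
Qed.

(** With [M] the maximum, the right side minus the left is [2 * M - phi cl + phi cu - (1 - cl) *
    dphi cl]. The subgradient inequality at [cl], tested at 1, gives
    [(1 - cl) * dphi cl <= - phi cl], and [phi] is nonnegative. *)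
Lemma subgradient_range_le cl cu : 0 < cl -> cl <= 1 -> 1 <= cu ->
  (phi cl - cl * dphi cl + dphi cu) - (phi cu - cu * dphi cu + dphi cl) <=
  2 * Num.max (phi cl) (phi cu) + dphi cu * cu + dphi cu - 2 * dphi cl.
Proof.
move=> cl0 cl1 cu1.
have := phi_sub cl0 ler01; rewrite phi1.
have p1 : phi cl <= Num.max (phi cl) (phi cu) by rewrite le_max lexx.
have p2 : phi cu <= Num.max (phi cl) (phi cu) by rewrite le_max lexx orbT.
have := divergence_ge0 (ltW cl0).
have := divergence_ge0 (le_trans ler01 cu1).
move: (Num.max _ _) p1 p2 => M; lra.
Qed.

End divergence.

(** * The cross U-statistic *)

Section cross_pairs.
Context {R : realType} {V : ptopologicalType} {dW : measure_display}
  {W : measurableType dW} {k : nat}.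
Local Notation X := (borel V * W)%type.
Local Notation Y := (label k).
Context {d0 : measure_display} {T0 : measurableType d0}.
Variables (f : {mfun X >-> Y}) (mu : probability (X * Y)%type R)
  (P : probability T0 R) (n : nat) (Z : 'I_n -> {RV P >-> (X * Y)%type}).
Hypothesis Z_iid : iid_with_law Z mu.

Definition cross (i j : 'I_n) (w : T0) : borel V * Y :=
  (viewpoint (Z i w), predicted f (Z j w)).

Lemma measurable_cross i j : measurable_fun setT (cross i j).
Proof.
by apply: measurable_fun_pair; apply: measurableT_comp.
Qed.

HB.instance Definition _ i j := isMeasurableFun.Build _ _ _ _
  (cross i j) (measurable_cross i j).

Lemma cross_diag_law i N : measurable N -> P (cross i i @^-1` N) = joint_law mu f N.
Proof.
move=> mN; rewrite -[LHS]/(distribution P (Z i) (view_pred f @^-1` N)) Z_iid.2//.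
by rewrite -[X in measurable X]setTI; exact: measurable_view_pred.
Qed.

(** A product measure is determined by rectangles, and on a rectangle the event splits into one
    condition on [Z i] and one on [Z j], which are independent. *)
Lemma cross_law i j N : i != j -> measurable N ->
  P (cross i j @^-1` N) = product_law mu f N.
Proof.
move=> ij mN; apply/esym.
apply: (product_measure_unique (m' := distribution P (cross i j))) => // A B mA mB.
have p_inj : injective (fun b : bool => if b then i else j).
  by move=> [] [] // /eqP; rewrite ?(negbTE ij) // eq_sym (negbTE ij).
pose C (b : bool) : set (X * Y) :=
  if b then @viewpoint V dW W k @^-1` A else predicted f @^-1` B.
have mC b : measurable (C b).
  rewrite /C -[X in measurable X]setTI; case: b.
    by apply: measurable_viewpoint.
  by apply: measurable_predicted.
have := iid_subfamily Z_iid p_inj mC.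
rewrite big_bool/= => <-.
rewrite /distribution/pushforward/=; congr (P _).
apply/seteqP; split=> w /=.
  by move=> [Aw Bw] [] _.
by move=> H; split; [exact: (H true)|exact: (H false)].
Qed.

Lemma integral_cross_diag i (F : borel V * Y -> R) lo hi : measurable_fun setT F ->
  (forall p, lo <= F p <= hi) ->
  (\int[P]_w (F (cross i i w))%:E = \int[joint_law mu f]_p (F p)%:E)%E.
Proof.
move=> mF Fb.
rewrite -(integral_distribution (P := P) (X := cross i i) (f := EFin \o F)).
- by apply: eq_measure_integral => N mN _; exact: cross_diag_law.
- exact/measurable_EFinP.
- apply: (@integrable_bounded_prob _ _ _ P (F \o cross i i) lo hi) => [|w].
    by apply: measurableT_comp => //; exact: measurable_cross.
  exact: Fb.
Qed.

Lemma integral_cross i j (F : borel V * Y -> R) lo hi : i != j ->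
  measurable_fun setT F -> (forall p, lo <= F p <= hi) ->
  (\int[P]_w (F (cross i j w))%:E = \int[product_law mu f]_p (F p)%:E)%E.
Proof.
move=> ij mF Fb.
rewrite -(integral_distribution (P := P) (X := cross i j) (f := EFin \o F)).
- by apply: eq_measure_integral => N mN _; exact: cross_law.
- exact/measurable_EFinP.
- apply: (@integrable_bounded_prob _ _ _ P (F \o cross i j) lo hi) => [|w].
    by apply: measurableT_comp => //; exact: measurable_cross.
  exact: Fb.
Qed.

(** The off-diagonal pair has the product law; the Radon-Nikodym derivative moves the integral to
    the joint law. *)
Lemma integral_cross_ratio i j (rstar F : borel V * Y -> R) lo hi : i != j ->
  product_law mu f `<< joint_law mu f -> is_prob_ratio mu f rstar ->
  measurable_fun setT F -> (forall p, lo <= F p <= hi) ->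
  (\int[P]_w (F (cross i j w))%:E = \int[joint_law mu f]_p (F p * rstar p)%:E)%E.
Proof.
move=> ij dom [r0 mr rE] mF Fb; rewrite (integral_cross ij mF Fb).
rewrite -(Radon_Nikodym_change_of_variables dom) //; last first.
  exact: (integrable_bounded_prob _ mF Fb).
apply: ae_eq_integral => //.
- apply: emeasurable_funM; first exact/measurable_EFinP.
  by [].
- by apply/measurable_EFinP; exact: measurable_funM.
- apply: filterS rE => p /(_ Logic.I)/= <- _.
  by rewrite EFinM.
Qed.

End cross_pairs.

Section cross_ustat.
Context {R : realType} {V : ptopologicalType} {dW : measure_display}
  {W : measurableType dW} {k : nat}.
Local Notation X := (borel V * W)%type.
Local Notation Y := (label k).
Context {d0 : measure_display} {T0 : measurableType d0}.
Variables (f : {mfun X >-> Y}) (mu : probability (X * Y)%type R)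
  (P : probability T0 R) (n : nat) (Z : 'I_n -> {RV P >-> (X * Y)%type}).
Hypotheses (n_ge2 : (2 <= n)%N) (Z_iid : iid_with_law Z mu).
Variables (h psi : borel V * Y -> R) (hl hu pl pu c D : R).
Hypotheses (mh : measurable_fun setT h) (mpsi : measurable_fun setT psi).
Hypotheses (hb : forall p, hl <= h p <= hu) (psib : forall p, pl <= psi p <= pu).
Hypothesis range_le : (hu + pu) - (hl + pl) <= c.

Definition cross_kernel (i j : 'I_n) (w : T0) : R :=
  h (cross f Z i i w) + psi (cross f Z i j w).

Hypothesis DE : forall i j, i != j -> (\int[P]_w (cross_kernel i j w)%:E = D%:E)%E.

Lemma measurable_cross_kernel i j : measurable_fun setT (cross_kernel i j).
Proof.
by apply: measurable_funD; apply: measurableT_comp => //; exact: measurable_cross.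
Qed.

Lemma cross_kernel_itv i j w : hl + pl <= cross_kernel i j w <= hu + pu.
Proof.
have /andP[h1 h2] := hb (cross f Z i i w).
have /andP[p1 p2] := psib (cross f Z i j w).
by rewrite !lerD.
Qed.

Lemma integral_deviation i j : i != j ->
  (\int[P]_w (D - cross_kernel i j w)%:E = 0)%E.
Proof.
move=> ij; under eq_integral do rewrite EFinB.
have iU := @integrable_bounded_prob _ _ _ P (cross_kernel i j) _ _
  (measurable_cross_kernel i j) (cross_kernel_itv i j).
rewrite integralB//; last exact: finite_measure_integrable_cst.
rewrite [X in (_ - X)%E](DE ij).
by rewrite [X in (X - _)%E]integral_probability_cst subee.
Qed.

Lemma cross_kernel_pair_mgf i j s : i != j -> 0 <= s ->
  (\int[P]_w (expR (s * (D - cross_kernel i j w)))%:E <=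
   (expR (s ^+ 2 * c ^+ 2 / 8))%:E)%E.
Proof.
move=> ij s0.
have mX : measurable_fun setT (fun w => D - cross_kernel i j w).
  by apply: measurable_funB => //; exact: measurable_cross_kernel.
have Xb w : D - (hu + pu) <= D - cross_kernel i j w <= D - (hl + pl).
  by have /andP[u1 u2] := cross_kernel_itv i j w; rewrite !lerD2l !lerN2 u1 u2.
apply: (le_trans (hoeffding_lemma mX Xb s0 (integral_deviation ij))).
rewrite lee_fin ler_expR ler_wpM2r// ?invr_ge0// ler_wpM2l ?sqr_ge0//.
(* The bounds at one point show that the interval has nonnegative length, so that the squares can be
   compared. *)
have /andP[h1 h2] := hb point; have /andP[p1 p2] := psib point.
rewrite ler_sqr ?nnegrE; have := range_le; lra.
Qed.

Lemma cross_kernel_mgf (p : 'I_n./2 * bool -> 'I_n) (s : R) : injective p -> 0 <= s ->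
  (\int[P]_w (\prod_(k < n./2)
     expR (s * (D - cross_kernel (p (k, false)) (p (k, true)) w)))%:E
   <= (expR (s ^+ 2 * c ^+ 2 / 8 *+ n./2))%:E)%E.
Proof.
move=> p_inj s0.
(* The label of the second point is the summation index. *)
pose alpha (l : Y) (z : X * Y) : R :=
  expR (s * (D - (h (view_pred f z) + psi (viewpoint z, l)))).
pose beta (l : Y) (z : X * Y) : R := \1_[set l] (predicted f z).
have factor i j w : expR (s * (D - cross_kernel i j w)) =
    \sum_l alpha l (Z i w) * beta l (Z j w).
  (* [beta l] tests whether the predicted label is [l], so exactly one term survives. *)
  rewrite (bigD1 (predicted f (Z j w)))//= big1 ?addr0 => [|l lNj].
    by rewrite /beta indicE mem_set// mulr1.
  by rewrite /beta indicE memNset ?mulr0//= => /esym/eqP; rewrite (negbTE lNj).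
have malpha l : measurable_fun setT (alpha l).
  apply: measurableT_comp => //; apply: measurable_funM => //.
  apply: measurable_funB => //; apply: measurable_funD.
    by apply: measurableT_comp => //; exact: measurable_view_pred.
  apply: (measurableT_comp (f := psi)) => //.
  by apply: measurable_fun_pair => //; exact: measurable_viewpoint.
have mbeta l : measurable_fun setT (beta l).
  by apply: measurableT_comp; [exact: measurable_indic|exact: measurable_predicted].
have alpha0 l z : 0 <= alpha l z by rewrite expR_ge0.
have beta0 l z : 0 <= beta l z by rewrite /beta indicE.
have alphab l z : 0 <= alpha l z <= expR (s * (D - (hl + pl))).
  rewrite expR_ge0/= ler_expR ler_wpM2l// lerB// lerD//.
    by have /andP[] := hb (view_pred f z).
  by have /andP[] := psib (viewpoint z, l).
have betab l z : 0 <= beta l z <= 1.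
  by rewrite /beta indicE; case: (_ \in _); rewrite /= ?lexx ?ler01.
pose a l := fine (\int[mu]_z (alpha l z)%:E)%E.
pose b l := fine (\int[mu]_z (beta l z)%:E)%E.
have aE l : (\int[mu]_z (alpha l z)%:E = (a l)%:E)%E.
  rewrite fineK//; apply: integrable_fin_num => //.
  exact: (integrable_bounded_prob _ (malpha l) (alphab l)).
have bE l : (\int[mu]_z (beta l z)%:E = (b l)%:E)%E.
  rewrite fineK//; apply: integrable_fin_num => //.
  exact: (integrable_bounded_prob _ (mbeta l) (betab l)).
(* A single pair, made of the samples of indices 0 and 1, identifies [\sum_l a l * b l] with the
   exponential moment bounded by Hoeffding's lemma. *)
have ab : (((\sum_l a l * b l) ^+ 1)%:E <= (expR (s ^+ 2 * c ^+ 2 / 8))%:E)%E.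
  pose i0 : 'I_n := Ordinal (ltnW n_ge2); pose i1 : 'I_n := Ordinal n_ge2.
  pose q (x : 'I_1 * bool) := if x.2 then i1 else i0.
  have q_inj : injective q.
    by move=> [x [|]] [y [|]] //= _; congr pair; rewrite !ord1.
  rewrite -(integral_iid_pairs Z_iid q_inj malpha mbeta alpha0 beta0 aE bE).
  under eq_integral do rewrite big_ord1 -factor.
  exact: cross_kernel_pair_mgf.
under eq_integral do under eq_bigr do rewrite factor.
rewrite (integral_iid_pairs Z_iid p_inj malpha mbeta alpha0 beta0 aE bE).
rewrite lee_fin -mulr_natl expRM_natl lerXn2r ?nnegrE ?expR_ge0//.
apply: sumr_ge0 => l _; rewrite mulr_ge0//.
  by rewrite fine_ge0//; apply: integral_ge0 => z _; rewrite lee_fin.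
by rewrite fine_ge0//; apply: integral_ge0 => z _; rewrite lee_fin.
Qed.

Lemma cross_ustat_concentration t : 0 < t ->
  exists2 E : set T0, measurable E /\ ((1 - expR (- t))%:E <= P E)%E &
    forall w, E w -> D <= ustat cross_kernel w + c * Num.sqrt (2 * t / n%:R).
Proof.
move=> t0; have /andP[h1 h2] := hb point; have /andP[p1 p2] := psib point.
have c_ge0 : 0 <= c by have := range_le; lra.
(* If [c = 0] the kernel is constant, equal to its mean [D], and the sure event works; the Chernoff
   argument divides by [c]. *)
have := c_ge0; rewrite le_eqVlt => /predU1P[c0|c_gt0].
  have U_cst i j w : cross_kernel i j w = hl + pl.
    have /andP[u1 u2] := cross_kernel_itv i j w; have := range_le; lra.
  have DU : D = hl + pl.
    have := DE (i := Ordinal (ltnW n_ge2)) (j := Ordinal n_ge2) isT.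
    under eq_integral do rewrite U_cst.
    by rewrite integral_probability_cst => -[].
  exists setT => [|w _].
    by split=> //; rewrite probability_setT lee_fin; have := expR_gt0 (- t); lra.
  rewrite -c0 mul0r addr0 /ustat.
  under eq_bigr do under eq_bigr do rewrite U_cst.
  rewrite sum_off_diagonal sumr_const card_ord -[_ *+ n]mulr_natl mulrA -natrM.
  rewrite [(n.-1 * n)%N]mulnC mulKf ?DU// pnatr_eq0; have := n_ge2; lia.
pose B := [set w | (c * Num.sqrt (2 * t / n%:R) <= D - ustat cross_kernel w)%R].
have mB : measurable B.
  rewrite (_ : B = ustat cross_kernel @^-1` `]-oo, D - c * Num.sqrt (2 * t / n%:R)]).
    rewrite -[X in measurable X]setTI.
    by apply: (measurable_ustat measurable_cross_kernel) => //; exact: measurable_itv.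
  by apply/seteqP; split=> w; rewrite /B /= in_itv/= lerBrDr lerBrDl addrC.
exists (~` B) => [|w /= /negP]; last by rewrite -ltNge => /ltW; lra.
split; first exact: measurableC.
rewrite probability_setC// EFinB leeB//.
apply: ustat_concentration => //.
- exact: measurable_cross_kernel.
- exact: cross_kernel_mgf.
Qed.

End cross_ustat.

(** Holds term by term: at the point of sample [i], with [r] and [rstar] for the values there, the
    subgradient inequality reads [phi rstar - rstar * dphi rstar <= phi r - r * dphi rstar]. The
    cross terms are equal, as [a] cancels the scaling of the test function. *)
Lemma subgradient_ustat_le {R : realType} {V W : Type} {k n : nat}
    (f : V * W -> label k) (S : 'I_n -> (V * W) * label k)
    (phi dphi : R -> R) (r rstar : V * label k -> R) (a : R) :
  (2 <= n)%N -> 0 < a -> subgradient_choice phi dphi -> (forall p, 0 <= r p) ->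
  (forall i, 0 < rstar ((S i).1.1, f (S i).1)) ->
  (n * n.-1)%:R^-1 * \sum_(i < n) \sum_(j < n | i != j)
    (phi (rstar ((S i).1.1, f (S i).1)) -
       rstar ((S i).1.1, f (S i).1) * dphi (rstar ((S i).1.1, f (S i).1)) +
     dphi (rstar ((S i).1.1, f (S j).1))) <=
  emp_phi_dependency f S phi r +
    a * mmd_stat f S r (fun p => dphi (rstar p) / a).
Proof.
move=> n2 a0 phi_sub r0 rs0; rewrite /emp_phi_dependency /mmd_stat.
have n0 : n%:R != 0 :> R by rewrite pnatr_eq0; lia.
have n10 : n.-1%:R != 0 :> R by rewrite pnatr_eq0; lia.
rewrite natrM mulrCA.
(* The mean over samples becomes a mean over ordered pairs, so that the sums can be merged. *)
have -> : n%:R^-1 * \sum_(i < n) phi (r ((S i).1.1, f (S i).1)) =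
    (n%:R * n.-1%:R)^-1 * \sum_(i < n) \sum_(j < n | i != j)
      phi (r ((S i).1.1, f (S i).1)).
  by rewrite sum_off_diagonal invfM -mulrA mulKf.
rewrite -mulrDr ler_wpM2l ?invr_ge0 ?mulr_ge0//.
rewrite mulr_sumr -big_split/=; apply: ler_sum => i _.
rewrite mulr_sumr -big_split/=; apply: ler_sum => j _.
rewrite mulrBr [r _ * _]mulrA !(mulrCA a) !mulfV ?gt_eqF// !mulr1.
by have := phi_sub _ (rs0 i) _ (r0 ((S i).1.1, f (S i).1)); lra.
Qed.

(** * Almost sure bounds on the ratio at all cross pairs *)

Section ratio_bounds.
Context {R : realType} {V : ptopologicalType} {dW : measure_display}
  {W : measurableType dW} {k : nat}.
Local Notation X := (borel V * W)%type.
Local Notation Y := (label k).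
Context {d0 : measure_display} {T0 : measurableType d0}.
Variables (f : {mfun X >-> Y}) (mu : probability (X * Y)%type R)
  (P : probability T0 R) (n : nat) (Z : 'I_n -> {RV P >-> (X * Y)%type}).
Hypothesis Z_iid : iid_with_law Z mu.
Hypothesis dom : product_law mu f `<< joint_law mu f.
Variables (rstar : borel V * Y -> R) (cl cu : R).
Hypothesis mr : measurable_fun setT rstar.
Hypothesis rb : {ae mu, forall z, cl <= rstar (view_pred f z) <= cu}.

Let N : set (borel V * Y) := [set p | cl <= rstar p <= cu].

Lemma measurable_ratio_bounds : measurable [set p | cl <= rstar p <= cu].
Proof.
rewrite (_ : [set p | _] = rstar @^-1` `[cl, cu]).
  by rewrite -[X in measurable X]setTI; apply: mr => //; exact: measurable_itv.
by apply/seteqP; split=> p; rewrite /= in_itv.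
Qed.

Let mN : measurable N := measurable_ratio_bounds.

Lemma joint_law_ratio_bounds : joint_law mu f (~` N) = 0%E.
Proof.
have mNC : measurable (view_pred f @^-1` (~` N)).
  rewrite -[X in measurable X]setTI; apply: measurable_view_pred => //.
  exact: measurableC.
exact: measure_negligible rb.
Qed.

(** The assumed bounds concern the joint law, that of the diagonal pairs; absolute continuity of the
    product law carries them to the others. *)
Lemma cross_ratio_bounds i j : P (cross f Z i j @^-1` (~` N)) = 0%E.
Proof.
have [->|ij] := eqVneq i j.
  by rewrite (cross_diag_law f Z_iid j (measurableC mN)) joint_law_ratio_bounds.
rewrite (cross_law f Z_iid ij (measurableC mN)).
move/null_content_dominatesP: dom; apply; first exact: measurableC.
exact: joint_law_ratio_bounds.
Qed.

Lemma ratio_bounds_measure1 : exists2 E : set T0, measurable E /\ P (~` E) = 0%E &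
  forall w, E w -> forall i j, cl <= rstar (cross f Z i j w) <= cu.
Proof.
have mC i j : measurable (cross f Z i j @^-1` N).
  by rewrite -[X in measurable X]setTI; exact: measurable_cross.
exists (\bigcap_(q : 'I_n * 'I_n) cross f Z q.1 q.2 @^-1` N); last first.
  by move=> w Ew i j; exact: (Ew (i, j)).
have mE : measurable (\bigcap_(q : 'I_n * 'I_n) cross f Z q.1 q.2 @^-1` N).
  by apply: fin_bigcap_measurable => //.
split => //.
apply: measure_negligible; first exact: measurableC.
have aeN : {ae P, forall w, forall q : 'I_n * 'I_n, N (cross f Z q.1 q.2 w)}.
  apply: filter_forall => -[i j] /=.
  exists (cross f Z i j @^-1` (~` N)); split => //.
  - exact: measurableC (mC i j).
  - exact: cross_ratio_bounds.
apply: negligibleS aeN => w Ew Nw; apply: Ew => q _; exact: Nw.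
Qed.

End ratio_bounds.

(** * The upper bound on the dependency measure *)

Theorem theorem1 (R : realType)
  (* the input domain, the labels and the hypothesis *)
  (V : ptopologicalType) (V_compact : compact [set: V])
  (dW : measure_display) (W : measurableType dW) (k : nat)
  (F : set {mfun (borel V * W)%type >-> label k})
  (f : {mfun (borel V * W)%type >-> label k}) (Ff : F f)
  (* the i.i.d. samples *)
  (mu : probability ((borel V * W) * label k)%type R)
  (d0 : measure_display) (T0 : measurableType d0) (P : probability T0 R)
  (n : nat) (n_ge2 : (2 <= n)%N)
  (Z : 'I_n -> {RV P >-> ((borel V * W) * label k)%type})
  (Z_iid : iid_with_law Z mu)
  (t : R) (t_gt0 : 0 < t)
  (* the divergence function *)
  (phi dphi : R -> R)
  (phi_div : divergence_function phi) (phi_sub : subgradient_choice phi dphi)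
  (* the probability ratio *)
  (prod_joint : product_law mu f `<< joint_law mu f)
  (rstar : V * label k -> R) (rstar_ratio : is_prob_ratio mu f rstar)
  (* the estimated ratio *)
  (G : set (V * label k -> R))
  (Omega : (V * label k -> R) -> \bar R) (Omega_Nnoo : forall r, Omega r != -oo%E)
  (rn : ('I_n -> (V * W) * label k) -> V * label k -> R)
  (rn_est : forall w : T0,
     is_ratio_estimate f (fun i => Z i w) G Omega (rn (fun i => Z i w)))
  (a : R) (a_gt0 : 0 < a) (G_sub : G (fun p => dphi (rstar p) / a))
  (cl cu : R) (cl_gt0 : 0 < cl) (cl_le1 : cl <= 1) (cu_ge1 : 1 <= cu)
  (rstar_bnd : {ae mu, forall z, cl <= rstar (view_pred f z) <= cu}) :
  let c := 2 * Num.max (phi cl) (phi cu) + dphi cu * cu + dphi cu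
           - 2 * dphi cl in
  exists2 E : set T0,
    measurable E /\ ((1 - expR (- t))%:E <= P E)%E &
    forall w, E w ->
      let S := fun i => Z i w in
      (phi_dependency mu f phi rstar <=
        (emp_phi_dependency f S phi (rn S))%:E + a%:E * mmd f S G (rn S)
        + (c * Num.sqrt (2 * t / n%:R))%:E)%E.
Proof.
move=> c.
have [_ _ phi1 _ sub1] := phi_div; have [r0 mr rE] := rstar_ratio.
have clcu : cl <= cu by exact: le_trans cu_ge1.
(* [rstar] and [rs] agree almost everywhere, but dphi is only monotone, hence
   measurable, on positive arguments. *)
pose rs (p : borel V * label k) := clamp cl cu (rstar p).
have rs_itv p : cl <= rs p <= cu by exact: clamp_itv.
have rs_gt0 p : 0 < rs p by have /andP[+ _] := rs_itv p; exact: lt_le_trans.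
have mrs : measurable_fun setT rs by apply: measurableT_comp mr; exact: measurable_clamp.
pose psi p := dphi (rs p).
pose h p := phi (rs p) - rs p * psi p.
have mpsi : measurable_fun setT psi.
  apply: (measurableT_comp (f := fun u => dphi (clamp cl cu u))) mr.
  exact: (measurable_subgradient_clamp phi_sub).
(* [phi] is constrained on nonnegative arguments only, so measurability goes through truncation at
   0, which does not change [r]. *)
have mphi (r : borel V * label k -> R) : (forall p, 0 <= r p) -> measurable_fun setT r ->
    measurable_fun setT (fun p => phi (r p)).
  move=> r_ge0 mr'; rewrite (_ : (fun p => _) = (fun u => phi (Num.max 0 u)) \o r).
    by apply: measurableT_comp mr'; exact: (measurable_divergence phi1 sub1 phi_sub).
  by apply/funext => p /=; rewrite max_r.
have mphirs : measurable_fun setT (fun p => phi (rs p)).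
  by apply: mphi => // p; exact: ltW (rs_gt0 p).
have mh : measurable_fun setT h.
  by apply: measurable_funB => //; exact: measurable_funM.
have psib p : dphi cl <= psi p <= dphi cu.
  have /andP[rs1 rs2] := rs_itv p.
  by apply/andP; split; apply: (subgradient_le phi_sub).
have hb p : phi cu - cu * dphi cu <= h p <= phi cl - cl * dphi cl.
  have /andP[rs1 rs2] := rs_itv p.
  by apply/andP; split; apply: (divergence_conjugate_ge phi_sub).
have rangec : (phi cl - cl * dphi cl + dphi cu) -
    (phi cu - cu * dphi cu + dphi cl) <= c.
  exact: subgradient_range_le.
have aers : ae_eq (joint_law mu f) setT rs rstar.
  exists (~` [set p | cl <= rstar p <= cu]); split.
  - by apply: measurableC; apply: measurable_ratio_bounds.
  - exact: joint_law_ratio_bounds.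
  - by move=> p /= Np bp; apply: Np => _; rewrite /rs clamp_id.
have phirsb p : 0 <= phi (rs p) <= Num.max (phi cl) (phi cu).
  rewrite (divergence_ge0 phi1 sub1)/=; last exact: ltW (rs_gt0 p).
  have /andP[rs1 rs2] := rs_itv p; rewrite le_max.
  have [r1|r1] := leP (rs p) 1.
    by rewrite (divergence_nonincreasing phi1 sub1 phi_sub)// ltW.
  by rewrite (divergence_nondecreasing phi1 sub1 phi_sub (ltW r1) rs2) orbT.
have phiE : phi_dependency mu f phi rstar = (\int[joint_law mu f]_p (phi (rs p))%:E)%E.
  rewrite /phi_dependency; apply: ae_eq_integral => //.
  - by apply/measurable_EFinP; exact: mphi.
  - by apply/measurable_EFinP.
  - by apply: filterS aers => p /= H /H ->.
(* The divergence is finite since [phi] is bounded along [rs], so it can be handled as a real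
   number. *)
pose D := fine (phi_dependency mu f phi rstar).
have DE : phi_dependency mu f phi rstar = D%:E.
  rewrite /D fineK// phiE; apply: integrable_fin_num => //.
  exact: (integrable_bounded_prob _ mphirs phirsb).
have kerE i j : i != j -> (\int[P]_w (cross_kernel f Z h psi i j w)%:E = D%:E)%E.
  move=> ij; rewrite /cross_kernel.
  under eq_integral do rewrite EFinD.
  rewrite integralD//; last 2 first.
  - apply: (@integrable_bounded_prob _ _ _ P (h \o cross f Z i i) _ _ _
      (fun w => hb _)).
    by apply: measurableT_comp => //; exact: measurable_cross.
  - apply: (@integrable_bounded_prob _ _ _ P (psi \o cross f Z i j) _ _ _
      (fun w => psib _)).
    by apply: measurableT_comp => //; exact: measurable_cross.
  rewrite (integral_cross_diag f Z_iid i mh hb).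
  rewrite (integral_cross_ratio Z_iid ij prod_joint rstar_ratio mpsi psib).
  rewrite -DE phiE.
  (* Almost everywhere [psi * rstar] is [phi (rs p) - h p], so the integral of [h] cancels and the
     divergence remains. *)
  have -> : (\int[joint_law mu f]_p (psi p * rstar p)%:E =
             \int[joint_law mu f]_p (phi (rs p) - h p)%:E)%E.
    apply: ae_eq_integral => //.
    - by apply/measurable_EFinP; exact: measurable_funM.
    - by apply/measurable_EFinP; exact: measurable_funB.
    - apply: filterS aers => p /= H /H <-; congr EFin.
      by rewrite /h opprB addrC subrK mulrC.
  under [X in (_ + X)%E]eq_integral do rewrite EFinB.
  rewrite integralB//; last 2 first.
  - exact: (integrable_bounded_prob _ mphirs phirsb).
  - exact: (integrable_bounded_prob _ mh hb).
  rewrite addeC subeK//; apply: integrable_fin_num => //.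
  exact: (integrable_bounded_prob _ mh hb).
have [E1 [mE1 PE1] E1D] :=
  cross_ustat_concentration n_ge2 Z_iid mh mpsi hb psib rangec kerE t_gt0.
have [E2 [mE2 PE2] E2r] := ratio_bounds_measure1 Z_iid prod_joint mr rstar_bnd.
(* [E1] carries the concentration bound; on [E2], of null complement, clamping changes the ratio at
   no cross pair. *)
exists (E1 `&` E2).
  split; first exact: measurableI.
  apply: (le_trans PE1).
  apply: (@le_trans _ _ (P ((E1 `&` E2) `|` ~` E2))).
    apply: le_measure; rewrite ?inE//.
      by apply: measurableU; [exact: measurableI|exact: measurableC].
    move=> w E1w; have [E2w|E2w] := pselect (E2 w); first by left.
    by right.
  apply: (le_trans (measureU2 _ _ _)); [exact: measurableI|exact: measurableC|].
  by rewrite [X in (_ + X)%E]PE2 adde0.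
move=> w [E1w E2w]; cbv zeta; set S := fun i => Z i w.
have rsE i j : rs (cross f Z i j w) = rstar (cross f Z i j w).
  by rewrite /rs clamp_id// E2r.
have rstar_gt0 i : 0 < rstar ((S i).1.1, f (S i).1).
  by have := rs_gt0 (cross f Z i i w); rewrite rsE.
have [rn_ge0 _] := rn_est w.
have := subgradient_ustat_le (f := f) (S := S) n_ge2 a_gt0 phi_sub rn_ge0 rstar_gt0.
rewrite [X in X <= _](_ : _ = ustat (cross_kernel f Z h psi) w); last first.
  rewrite /ustat; congr (_ * _); apply: eq_bigr => i _; apply: eq_bigr => j _.
  by rewrite /cross_kernel /h /psi !rsE.
move=> T_le; rewrite DE.
(* The value at the test function [dphi (rstar p) / a], a member of [G], is a lower bound for the
   supremum. *)
apply: (@le_trans _ _ ((emp_phi_dependency f S phi (rn S))%:E +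
  a%:E * (mmd_stat f S (rn S) (fun p => dphi (rstar p) / a))%:E +
  (c * Num.sqrt (2 * t / n%:R))%:E)%E).
  by rewrite -EFinM -!EFinD lee_fin (le_trans (E1D w E1w))// lerD2r.
rewrite leeD2r// leeD2l// lee_pmul2l ?lte_fin//.
by apply: ereal_sup_ubound; exists (fun p => dphi (rstar p) / a).
Qed.
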